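(* Let $M$ be a matching with a separated layout. If the largest diamond-pattern in $M$ has size $k \times k$, then the mixed page number of $M$ is at least $k$ and at most $2k$.
   Context: An ordered graph is a graph with a fixed total order $\prec$ on its vertices. A stack is a set of edges no two of which cross (have alternating endpoints); a queue is a set of edges no two of which nest (i.e., no $u \prec x \prec y \prec v$ with $uv$ and $xy$ both in it). The mixed page number of an ordered graph is the minimum number of parts in a partition of its edges where each part is a stack or a queue. A linear layout of a bipartite graph $G=(V_1\cup V_2,E)$ is separated if all vertices of $V_1$ precede all vertices of $V_2$. In the grid representation of a separated layout, each edge $e$ is a point with $x(e)$ the position of its $V_1$-endpoint and $y(e)$ the position of its $V_2$-endpoint. Write $e_1 \nearrow e_2$ if $x(e_1)<x(e_2)$ and $y(e_1)<y(e_2)$, and $e_1 \searrow e_2$ if $x(e_1)<x(e_2)$ and $y(e_1)>y(e_2)$. A $k$-diamond-pattern is a set of $k^2$ edges $e_{i,j}$, $1\le i,j\le k$, such that $e_{i,j}\nearrow e_{i,j+1}$ for all $1\le i\le k$, $1\le j<k$, and $e_{i,j}\searrow e_{i+1,j}$ for all $1\le i<k$, $1\le j\le k$; its size is denoted $k\times k$. *)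

(* Defs.v *)
(* Mathematical Components. *)
From HB Require Import structures.
From mathcomp Require Import all_boot all_order.

Set Implicit Arguments.
Unset Strict Implicit.
Unset Printing Implicit Defensive.

(* The vertex order of an ordered graph is the order of its vertex type, which
   is a [finOrderType].                                                       *)
Record ordered_graph (d : Order.disp_t) (V : finOrderType d) := OrderedGraph {
  adj : rel V;
  adj_sym : symmetric adj;
  adj_irr : irreflexive adj
}.

Section OrderedGraph.

Variables (d : Order.disp_t) (V : finOrderType d).
Implicit Types (G : ordered_graph V) (e f : V * V) (S D : {set V * V}).
Implicit Types k : nat.

(* An undirected edge uv is represented exactly once, by the pair listing its
   smaller endpoint first.                                                    *)
Definition edges G : {set V * V} := [set e | (e.1 < e.2)%O && adj G e.1 e.2].

Definition cross e f : bool :=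
  [|| [&& e.1 < f.1, f.1 < e.2 & e.2 < f.2]
    | [&& f.1 < e.1, e.1 < f.2 & f.2 < e.2]]%O.

(* For edges e = uv and f = xy, this is u < x < y < v. *)
Definition nests e f : bool := [&& e.1 < f.1, f.1 < f.2 & f.2 < e.2]%O.

Definition is_stack S : bool := [forall e in S, forall f in S, ~~ cross e f].

Definition is_queue S : bool := [forall e in S, forall f in S, ~~ nests e f].

Definition mixed_layout G (P : {set {set V * V}}) : bool :=
  partition P (edges G) && [forall S in P, is_stack S || is_queue S].

Lemma mixed_layout_exists G :
  exists n, [exists P : {set {set V * V}}, mixed_layout G P && (#|P| == n)].
Proof.
pose P := preim_partition id (edges G).
exists #|P|; apply/existsP; exists P; rewrite eqxx andbT.
apply/andP; split; first exact: preim_partitionP.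
apply/forall_inP => S /imsetP[e0 _ ->]; apply/orP; left.
apply/forall_inP => e; rewrite inE => /andP[_ /eqP <-].
apply/forall_inP => f; rewrite inE => /andP[_ /eqP <-].
by rewrite /cross !Order.POrderTheory.ltxx.
Qed.

Definition mixed_page_number G : nat := ex_minn (mixed_layout_exists G).

Definition is_matching G : Prop := forall v, #|[set w | adj G v w]| <= 1.

Definition bipartition G (V1 V2 : {set V}) : Prop :=
  [/\ V1 :|: V2 = [set: V], [disjoint V1 & V2] &
      forall u v, adj G u v ->
        (u \in V1) && (v \in V2) || (u \in V2) && (v \in V1)].

Definition separated (V1 V2 : {set V}) : Prop :=
  forall u v, u \in V1 -> v \in V2 -> (u < v)%O.

Definition pos (v : V) : nat := #|[set w | (w < v)%O]|.

(* For an edge of a graph with bipartition (V1, V2), [gridx V1 e] and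
   [gridy V2 e] are the positions of its endpoints in V1 and in V2.           *)
Definition gridx (V1 : {set V}) e : nat := pos (if e.1 \in V1 then e.1 else e.2).
Definition gridy (V2 : {set V}) e : nat := pos (if e.1 \in V2 then e.1 else e.2).

Definition northeast (V1 V2 : {set V}) e f : bool :=
  (gridx V1 e < gridx V1 f) && (gridy V2 e < gridy V2 f).

Definition southeast (V1 V2 : {set V}) e f : bool :=
  (gridx V1 e < gridx V1 f) && (gridy V2 f < gridy V2 e).

Definition diamond_pattern G (V1 V2 : {set V}) k D : Prop :=
  [/\ D \subset edges G, #|D| = k ^ 2 &
      exists E : 'I_k -> 'I_k -> V * V,
        [/\ D = [set E i j | i : 'I_k, j : 'I_k],
            forall i j j' : 'I_k, nat_of_ord j' = j.+1 ->
              northeast V1 V2 (E i j) (E i j') &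
            forall i i' j : 'I_k, nat_of_ord i' = i.+1 ->
              southeast V1 V2 (E i j) (E i' j)]].

Definition largest_diamond G (V1 V2 : {set V}) k : Prop :=
  (exists D, diamond_pattern G V1 V2 k D) /\
  (forall k' D, diamond_pattern G V1 V2 k' D -> k' <= k).

End OrderedGraph.

(* Main.v *)
Require Import Defs.
From mathcomp Require Import all_boot all_order.
From mathcomp Require Import all_fingroup all_algebra zify.

Set Implicit Arguments.
Unset Strict Implicit.
Unset Printing Implicit Defensive.

Import Order.TTheory GRing.Theory Num.Theory.

(* In the grid, a stack is a set of points without a northeast pair and a queue
   one without a southeast pair.  A page meets each row (resp. each column) of a
   diamond at most once, which gives the lower bound.

   For the upper bound, take a permutation s of the points of minimal cost, where
   a step from a to b costs 0 if b is northeast of a, 2 if b = a, and 2k + 1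
   otherwise.  Cutting the cycles of s at the steps that are not northeast
   splits the points moved by s into northeast chains.  Linear programming
   duality gives potentials alpha, beta between 0 and 2k + 1 such that, for each
   threshold l, the points a with alpha a < l <= beta a contain no northeast
   pair.  A point fixed by s satisfies beta a = alpha a + 2, so it lies in one
   of the k levels l = 2, 4, ..., 2k.  Hence if there are at most k chains, 2k
   pages suffice.  Otherwise every chain crosses each of the k + 1 levels
   l = 1, 3, ..., 2k + 1, in different points, and sorting the crossing points of
   k + 1 chains within every level yields a (k + 1)-diamond. *)

(** * Duality for the assignment problem *)

Section AssignmentDuality.

Variable T : finType.
Local Open Scope ring_scope.

Section Potential.

Variable w : T -> T -> int.

Fixpoint walk_weight (a : T) (p : seq T) : int :=
  if p is b :: p' then w a b + walk_weight b p' else 0.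

Lemma walk_weight_cat a p q :
  walk_weight a (p ++ q) = walk_weight a p + walk_weight (last a p) q.
Proof. by elim: p a => [|b p IH] a /=; rewrite ?add0r // IH addrA. Qed.

Lemma walk_weight_next a0 a p : uniq (a :: p) ->
  \sum_(b <- a :: p) w b (next_at b a0 a p) = walk_weight a (rcons p a0).
Proof.
elim: p a => [|b p IH] a; first by rewrite big_seq1 /= eqxx addr0.
move=> /= /and3P[aNp bp up].
rewrite big_cons eqxx; congr (_ + _).
have := IH b; rewrite /= bp up => <- //.
rewrite [LHS]big_seq [RHS]big_seq; apply: eq_bigr => z zp.
by case: eqP => // za; rewrite za (negPf aNp) in zp.
Qed.

(** The potential of [a] is minus the least weight of a simple path starting at [a]; bounding
    lengths by [#|T|] makes the minimum range over a finite type. *)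
Lemma potential_exists :
  (forall a p, uniq (a :: p) -> 0 <= walk_weight a (rcons p a)) ->
  exists d : T -> int, forall a b, d b <= d a + w a b.
Proof.
move=> cycle_ge0.
pose simple a (p : {bseq #|T| of T}) := uniq (a :: p).
pose best a : {bseq #|T| of T} := [arg min_(p < [bseq] | simple a p) walk_weight a p]%O.
exists (fun a => - walk_weight a (best a)) => a b.
have bestP c : simple c (best c) /\
    forall p, uniq (c :: p) -> walk_weight c (best c) <= walk_weight c p.
  rewrite /best; case: arg_minP => // p cp pmin; split=> // q cq.
  have sz : (size q <= #|T|)%N.
    by apply: leq_trans (max_card (mem (c :: q))); rewrite (card_uniqP cq) /=.
  exact: (pmin (Bseq sz)).
suff: walk_weight a (best a) <= w a b + walk_weight b (best b) by lia.
have [bu _] := bestP b; have [_ amin] := bestP a.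
have [ab|aNb] := boolP (a \in b :: best b); last first.
  by apply: (amin (b :: best b)); rewrite /= aNb.
(* If [a] lies on the best path from [b], the part up to [a] closes a cycle of nonnegative weight
   and the rest is a simple path from [a]. *)
rewrite -[w a b + _]/(walk_weight a (b :: best b)).
move: bu; rewrite /simple; case/splitPr: ab => p1 p2.
rewrite cat_uniq => /and3P[u1 aN u2].
rewrite -cat_rcons walk_weight_cat last_rcons.
have := amin p2 u2; have := cycle_ge0 a p1.
by move: aN; rewrite /= negb_or u1 => /andP[-> _] /(_ isT) ? ?; lia.
Qed.

End Potential.

(* The potentials are shortest-walk distances in the residual graph of an optimal
   permutation; a negative cycle there would yield a cheaper permutation. *)
Lemma assignment_dual (c : T -> T -> nat) :
  exists (s : {perm T}) (alpha beta : T -> nat),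
    [/\ forall a b, (beta b <= alpha a + c a b)%N,
        forall a, beta (s a) = (alpha a + c a (s a))%N &
        T -> exists a, alpha a = 0%N].
Proof.
pose cost (s : {perm T}) := (\sum_a c a (s a))%N.
pose s : {perm T} := [arg min_(t < 1%g) cost t]%N.
have smin t : (cost s <= cost t)%N by rewrite /s; case: arg_minnP => // r _; apply.
(* The weight of an arc is the change of cost when [a] takes over the image of [b]. *)
pose w a b : int := (c a (s b))%:Z - (c a (s a))%:Z.
have [|d dP] := @potential_exists w.
  move=> a p up; rewrite -walk_weight_next //.
  have ninj : injective (next (a :: p)) := can_inj (prev_next up).
  have wE : \sum_(b <- a :: p) w b (next (a :: p) b) = \sum_b w b (next (a :: p) b).
    rewrite big_uniq // big_mkcond; apply: eq_bigr => b _.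
    by case: ifPn => // bNp; rewrite next_nth (negPf bNp) /w subrr.
  rewrite [X in _ <= X]wE.
  (* Following the cycle first and then [s] changes the cost of [s] by exactly the weight of the
     cycle. *)
  have := smin (perm ninj * s)%g; rewrite -lez_nat /cost.
  rewrite !(big_morph Posz PoszD (erefl _)) -subr_ge0 -sumrB.
  by under eq_bigr do rewrite permM permE.
pose al a : int := d a - (c a (s a))%:Z.
pose be b : int := d (s^-1 b)%g.
have abP a b : be b <= al a + (c a b)%:Z.
  by have := dP a (s^-1 b)%g; rewrite /w permKV /be /al; lia.
have abE a : be (s a) = al a + (c a (s a))%:Z by rewrite /be permK /al; lia.
have [a0 _|T0] := pickP T; last first.
  by exists s, (fun=> 0%N), (fun=> 0%N); split=> a; have := T0 a.
(* Both potentials are shifted by the minimum of [al], which also bounds [be] from below because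
   costs are nonnegative. *)
pose am := [arg min_(a < a0) al a]%O.
have amin a : al am <= al a by rewrite /am; case: arg_minP => // r _; apply.
exists s, (fun a => `|al a - al am|%N), (fun a => `|be a - al am|%N).
have bege a : al am <= be a.
  by rewrite -(permKV s a) abE; have := amin (s^-1 a)%g; lia.
split=> [a b|a|_].
- by have := abP a b; have := amin a; have := bege b; lia.
- by have := abE a; have := amin a; have := bege (s a); lia.
- by exists am; rewrite subrr.
Qed.

End AssignmentDuality.

(** * Diamonds in a finite planar point set *)

Section PointSets.

Variables (T : finType) (x y : T -> nat).
Hypotheses (x_inj : injective x) (y_inj : injective y).

Definition ne a b := (x a < x b) && (y a < y b).
Definition se a b := (x a < x b) && (y b < y a).

Lemma ne_trans : transitive ne.
Proof. by move=> b a c; rewrite /ne; lia. Qed.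

Lemma se_trans : transitive se.
Proof. by move=> b a c; rewrite /se; lia. Qed.

Lemma ord_increasing n (R : rel T) (F : 'I_n -> T) : transitive R ->
  (forall i i' : 'I_n, i' = i.+1 :> nat -> R (F i) (F i')) ->
  forall i j : 'I_n, i < j -> R (F i) (F j).
Proof.
move=> tr st i [j jn] /=; elim: j jn => // j IH jn; rewrite ltnS leq_eqVlt.
have st' : R (F (Ordinal (ltnW jn))) (F (Ordinal jn)) by apply: st.
by case/predU1P => [ij|/(IH (ltnW jn))/tr]; [apply: st; rewrite /= ij|apply].
Qed.

Definition diamond n (E : 'I_n -> 'I_n -> T) : Prop :=
  (forall i j j' : 'I_n, j' = j.+1 :> nat -> ne (E i j) (E i j')) /\
  (forall i i' j : 'I_n, i' = i.+1 :> nat -> se (E i j) (E i' j)).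

Section Diamond.

Variables (n : nat) (E : 'I_n -> 'I_n -> T).
Hypothesis diaE : diamond E.

Lemma diamond_row i (j j' : 'I_n) : j < j' -> ne (E i j) (E i j').
Proof. exact: ord_increasing ne_trans (diaE.1 i) j j'. Qed.

Lemma diamond_col (i i' : 'I_n) j : i < i' -> se (E i j) (E i' j).
Proof.
exact: (ord_increasing (F := E^~ j) se_trans (fun a b => diaE.2 a b j)).
Qed.

(** If the rows differed, [E i j'] and [E i j] would form a southeast pair through column [j'],
    although they share row [i]. *)
Lemma diamond_inj i j i' j' : E i j = E i' j' -> (i, j) = (i', j').
Proof.
wlog ii' : i j i' j' / i <= i' => [wl|].
  by case: (leqP i i') => [|/ltnW] h eqE; [apply: wl|apply/esym/wl].
move=> eqE; have eq_i : i = i'.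
  apply: val_inj; apply/eqP; rewrite eqn_leq ii' leqNgt; apply/negP => lt_ii'.
  have := diamond_col j' lt_ii'; rewrite /se -eqE.
  case: (ltngtP j j') => [/(diamond_row i)|/(diamond_row i)|/val_inj->];
    by rewrite /ne; lia.
rewrite -{}eq_i in eqE *; congr (_, _); apply: val_inj => /=.
by case: (ltngtP j j') => // /(diamond_row i); rewrite eqE /ne !ltnn.
Qed.

Lemma card_diamond : #|[set E i j | i : 'I_n, j : 'I_n]| = n ^ 2.
Proof.
have -> : [set E i j | i : 'I_n, j : 'I_n] = [set E p.1 p.2 | p : 'I_n * 'I_n].
  apply/setP => a; apply/imset2P/imsetP => [[i j _ _ ->]|[[i j] _ ->]].
    by exists (i, j).
  by exists i j.
rewrite card_imset => [|[i j] [i' j'] /diamond_inj //].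
by rewrite card_prod card_ord -mulnn.
Qed.

End Diamond.

(** Otherwise [g b <= f a], and every [c] with [g c <= g b], including [b] itself, would satisfy
    [f c < f a], so the ranks would differ. *)
Lemma order_statistic_lt (I : finType) (f g : I -> nat) (a b : I) :
  (forall c, f c < g c) ->
  #|[set c | f c < f a]| = #|[set c | g c < g b]| -> f a < g b.
Proof.
move=> fg eq_rank; rewrite ltnNge; apply/negP => gf.
suff: #|[set c | g c < g b]| < #|[set c | f c < f a]| by rewrite eq_rank ltnn.
apply: proper_card; apply/properP; split.
  by apply/subsetP => c; rewrite !inE; have := fg c; lia.
by exists b; rewrite inE ?ltnn //; have := fg b; lia.
Qed.

Lemma rank_surj (I : finType) (f : I -> nat) n : injective f -> n < #|I| ->
  exists a, #|[set c | f c < f a]| = n.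
Proof.
move=> f_inj nI.
have rlt a : #|[set c | f c < f a]| < #|I|.
  rewrite -cardsT; apply: proper_card; apply/properP; split; first exact: subsetT.
  by exists a; rewrite !inE ?ltnn.
pose r a := Ordinal (rlt a).
have r_inj : injective r.
  have rank_lt a b : f a < f b ->
      #|[set c | f c < f a]| < #|[set c | f c < f b]|.
    move=> fab; apply: proper_card; apply/properP; split.
      by apply/subsetP => c; rewrite !inE; lia.
    by exists a; rewrite inE ?ltnn.
  move=> a b /(congr1 val) /= eq_r; apply: f_inj.
  by case: (ltngtP (f a) (f b)) => // /rank_lt; rewrite eq_r ltnn.
have [a _ aE] : exists2 a, a \in [set: I] & Ordinal nI = r a.
  apply/imsetP; rewrite (_ : r @: _ = [set: 'I_#|I|]) ?inE //.
  by apply/eqP; rewrite eqEcard subsetT card_imset // !cardsT card_ord leqnn.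
by exists a; rewrite [LHS](congr1 val (esym aE)).
Qed.

(** Row [i] collects the points of rank [i] by [x] in each level; comparing order statistics shows
    that it ascends even where it switches between chains. *)
Lemma sort_levels (n : nat) (I : finType) (z : I -> 'I_n -> T) : #|I| = n ->
  (forall i (j j' : 'I_n), j' = j.+1 :> nat -> ne (z i j) (z i j')) ->
  (forall i i' j, i != i' -> z i j != z i' j /\ ~~ ne (z i j) (z i' j)) ->
  exists E : 'I_n -> 'I_n -> T, diamond E.
Proof.
move=> cardI z_ne z_anti.
have zj_inj j : injective (z^~ j).
  by move=> i i' eq_z; apply/eqP; apply: contraT => /z_anti-/(_ j)[]; rewrite eq_z eqxx.
have xz_inj j : injective (fun i => x (z i j)).
  by move=> i i' /x_inj; apply: zj_inj.
have z_rev i i' j : (y (z i' j) < y (z i j)) = (x (z i j) < x (z i' j)).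
  have [->|ii'] := eqVneq i i'; first by rewrite !ltnn.
  have [zd n1] := z_anti i i' j ii'; have [_ n2] := z_anti i' i j (contra_neq esym ii').
  have: x (z i j) <> x (z i' j) by move/x_inj/eqP; apply/negP.
  have: y (z i j) <> y (z i' j) by move/y_inj/eqP; apply/negP.
  by move: n1 n2; rewrite /ne; lia.
have rk (i j : 'I_n) : exists a, #|[set c | x (z c j) < x (z a j)]| == i.
  have [|a <-] := @rank_surj _ (fun c => x (z c j)) i (@xz_inj j); first by rewrite cardI.
  by exists a.
pose e i j := xchoose (rk i j).
have eE i j : #|[set c | x (z c j) < x (z (e i j) j)]| = i by apply/eqP/(xchooseP (rk i j)).
exists (fun i j => z (e i j) j); split.
  move=> i j j' jj'; apply/andP; split.
    apply: (@order_statistic_lt _ (fun c => x (z c j)) (fun c => x (z c j'))).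
      by move=> c; case/andP: (z_ne c j j' jj').
    by rewrite !eE.
  (* Within a level [y] reverses [x], so the same rank counts the points lying above, and the
     comparison can be repeated for [y]. *)
  rewrite ltnNge; apply/negP => yy.
  suff: #|[set c | x (z c j) < x (z (e i j) j)]| < #|[set c | x (z c j') < x (z (e i j') j')]|.
    by rewrite !eE ltnn.
  apply: proper_card; apply/properP; split.
    apply/subsetP => c; rewrite !inE -!z_rev.
    by case/andP: (z_ne c j j' jj') => _; lia.
  exists (e i j); rewrite inE ?ltnn // -z_rev.
  by case/andP: (z_ne (e i j) j j' jj') => _; lia.
move=> i i' j ii'; rewrite /se z_rev andbb ltnNge; apply/negP => xx.
suff: #|[set c | x (z c j) < x (z (e i' j) j)]| <= #|[set c | x (z c j) < x (z (e i j) j)]|.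
  by rewrite !eE ii' ltnn.
by apply: subset_leq_card; apply/subsetP => c; rewrite !inE; lia.
Qed.

(** * Northeast chains cut from the cycles of a permutation *)

Section Chains.

Variable s : {perm T}.

Definition ascent a := ne a (s a).
Definition moved a := s a != a.
Definition step a := if ascent a then s a else a.
(** Each ascent raises [x] by at least one, so this many iterations suffice to reach a point where
    [step] halts. *)
Definition chain_end a := iter (\max_b x b).+1 step a.
Definition ends := [set a | moved a && ~~ ascent a].

Lemma iter_ascent n a : ascent (iter n step a) -> x a + n <= x (iter n step a).
Proof.
elim: n => [|n IH] /=; first by rewrite addn0.
set b := iter n step a in IH *; rewrite /step.
case: ifP => [bs _|->] //; have := IH bs; move: bs; rewrite /ascent /ne; lia.
Qed.

Lemma chain_end_nascent a : ~~ ascent (chain_end a).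
Proof.
apply/negP => /iter_ascent; apply/negP; rewrite -ltnNge.
apply: (@leq_ltn_trans (\max_b x b)); first exact: leq_bigmax.
by rewrite addnS ltnS leq_addl.
Qed.

Lemma chain_end_step a : chain_end (step a) = chain_end a.
Proof.
rewrite {1}/chain_end -iterSr iterS -/(chain_end a) {1}/step.
by rewrite (negPf (chain_end_nascent a)).
Qed.

Lemma moved_step a : moved (step a) = moved a.
Proof. by rewrite /moved /step; case: ifP => // _; rewrite (inj_eq perm_inj). Qed.

Lemma chain_end_in_ends a : moved a -> chain_end a \in ends.
Proof.
move=> am; rewrite inE chain_end_nascent andbT /chain_end.
by elim: _.+1 => //= n IH; rewrite moved_step.
Qed.

Lemma step_id a : ~~ ascent a -> step a = a.
Proof. by rewrite /step => /negbTE->. Qed.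

Lemma chain_end_id a : a \in ends -> chain_end a = a.
Proof.
rewrite inE => /andP[_ aN]; rewrite /chain_end.
by elim: _.+1 => //= n ->; rewrite step_id.
Qed.

Lemma step_eq a b : step a = step b -> [\/ a = b, a = step b | b = step a].
Proof.
rewrite /step; case: ifP => _; case: ifP => _ ab.
- by constructor 1; apply: perm_inj ab.
- by constructor 3.
- by constructor 2.
- by constructor 1.
Qed.

(** [step] merges two distinct points only if one is the image of the other, so tracing back from a
    common iterate stays on one orbit. *)
Lemma iter_step_comparable n a b : iter n step a = iter n step b ->
  (exists i, b = iter i step a) \/ (exists i, a = iter i step b).
Proof.
have back i c d : step d = iter i step c ->
    (exists i, d = iter i step c) \/ (exists i, c = iter i step d).
  elim: i => [|i IH]; first by move=> /= <-; right; exists 1.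
  case/step_eq => [->|->|/esym/IH //]; first by left; exists i.
  by left; exists i.+1.
elim: n a b => [|n IH] a b; first by move=> /= ->; left; exists 0.
rewrite !iterSr => /IH [] [i]; rewrite -iterSr => /back // [] ?; by [right|left].
Qed.

Lemma iter_step_ne i a : iter i step a = a \/ ne a (iter i step a).
Proof.
elim: i => [|i IH]; first by left.
rewrite iterS /step; case: ifP => // asc; right.
by case: IH asc => [-> //|h]; apply: ne_trans.
Qed.

Lemma chain_comparable a b : chain_end a = chain_end b ->
  [\/ a = b, ne a b | ne b a].
Proof.
case/iter_step_comparable => [] [i] E.
  by have [<-|] := iter_step_ne i a; rewrite -E; [constructor 1|constructor 2].
by have [<-|] := iter_step_ne i b; rewrite -E; [constructor 1|constructor 3].
Qed.

(** The leftmost point of the chain works: an ascent into it from its preimage would give a point of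
    the same chain further left. *)
Lemma chain_start a : moved a ->
  exists b, [/\ moved b, chain_end b = chain_end a & (s^-1)%g b \in ends].
Proof.
move=> am; pose C b := moved b && (chain_end b == chain_end a).
have Ca : C a by rewrite /C am eqxx.
case: (arg_minnP x Ca) => b /andP[bm /eqP be] bmin; exists b; split=> //.
have cm : moved (s^-1 b)%g.
  by rewrite /moved permKV; apply: contraNneq bm => bE; rewrite /moved {1}bE permKV.
rewrite inE cm; apply/negP => asc.
have cs : step (s^-1 b)%g = b by rewrite /step asc permKV.
have := bmin (s^-1 b)%g; rewrite /C cm -chain_end_step cs be eqxx => /(_ isT).
by move: asc; rewrite /ascent permKV /ne; lia.
Qed.

End Chains.

(** Colours [inl] come from the chains, colours [inr] from the even levels met by fixed points. *)
Lemma diamond_or_coloring k :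
  (exists E : 'I_k.+1 -> 'I_k.+1 -> T, diamond E)
  \/ (exists col : T -> 'I_k + 'I_k, forall a b, col a = col b ->
        if col a is inl _ then ~~ se a b else ~~ ne a b).
Proof.
have [a0 _|T0] := pickP T; last first.
  have T0' (a : T) : False by have := T0 a.
  by right; exists (fun a => False_rect _ (T0' a)) => a; have := T0 a.
case: k => [|k].
  left; exists (fun _ _ => a0); split=> i j j'; rewrite !ord1 //.
set K := k.+1.
(* The value 2 lets the levels above [alpha a] and up to [beta a] include at most one odd level;
   [K.*2.+1] leaves room for [K.+1] odd levels. *)
pose c a b := if ne a b then 0 else if a == b then 2 else K.*2.+1.
have [s [alpha [beta [bP bE az]]]] := assignment_dual c.
have {az} [am am0] := az a0.
have bmax b : beta b <= K.*2.+1.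
  by have := bP am b; rewrite am0 add0n /c; do ?case: ifP => _; lia.
have b_ne a b : ne a b -> beta b <= alpha a.
  by move=> ab; have := bP a b; rewrite /c ab addn0.
have neaa a : ne a a = false by rewrite /ne ltnn.
have b2 a : beta a <= alpha a + 2 by have := bP a a; rewrite /c neaa eqxx.
have b_fix a : s a = a -> beta a = alpha a + 2.
  by move=> sa; have := bE a; rewrite /c sa neaa eqxx.
have b_asc a : ascent s a -> beta (s a) = alpha a.
  by rewrite /ascent => asc; rewrite bE /c asc addn0.
(* The full cost [K.*2.+1] already equals the upper bound on [beta], which forces [alpha a] to
   vanish. *)
have b_end a : a \in ends s -> beta (s a) = K.*2.+1 /\ alpha a = 0.
  rewrite inE => /andP[am' /negbTE asc].
  have := bE a; have := bmax (s a); move: asc am'; rewrite /c /ascent /moved eq_sym.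
  by move=> -> /negbTE->; lia.
have [few|many] := leqP #|ends s| K.
  (* Half of [alpha a], rounded down, is [m] exactly when the fixed point [a] meets the even level
     [2 * (m + 1)]. *)
  right; exists (fun a => if s a == a then inr (inord (alpha a)./2)
                      else inl (inord (index (chain_end s a) (enum (ends s))))) => a b.
  have [sa|sa] := eqVneq (s a) a; have [sb|sb] := eqVneq (s b) b => //.
    case=> /(congr1 val) /=; rewrite !inordK.
    - move=> ab; apply/negP => /b_ne; have := b_fix _ sb; have := b_fix _ sa; lia.
    - have := b_fix _ sb; have := bmax b; lia.
    - have := b_fix _ sa; have := bmax a; lia.
  case=> /(congr1 val) /=.
  have lt z : s z != z -> index (chain_end s z) (enum (ends s)) < k.+1.
    move=> sz; apply: leq_trans few.
    by rewrite cardE index_mem mem_enum chain_end_in_ends.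
  rewrite !inordK ?lt // => /(congr1 (nth a0 (enum (ends s)))).
  rewrite !nth_index ?mem_enum ?chain_end_in_ends //.
  case/chain_comparable => [->||]; rewrite /ne /se; lia.
left.
pose N := K.+1.
(* Only [K.+1] ends are kept, since [sort_levels] takes as many chains as levels. *)
pose I : finType := {e : T | e \in take N (enum (ends s))}.
have cI : #|I| = N.
  rewrite card_sig.
  rewrite (card_uniqP (take_uniq _ (enum_uniq _))) size_take -cardE.
  by case: ltnP => //; lia.
have Iends (e : I) : val e \in ends s.
  by rewrite -mem_enum; apply: mem_take (valP e).
(* Levels are listed from the top: a chain starts with [beta] equal to [K.*2.+1] and ends with
   [alpha] equal to 0. *)
pose lev (j : 'I_N) := (K - j).*2.+1.
(* [z e j] below is the last point of the chain ending in [e] whose [beta] reaches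
   the level; the chain leaves the level there for good, so lower levels are
   crossed later. *)
pose L (e : I) j a := [&& moved s a, chain_end s a == val e & lev j <= beta a].
have Lex e j : exists a, L e j a.
  have em : moved s (val e) by have := Iends e; rewrite inE => /andP[].
  (* The start of the chain is the image of an end, so its [beta] reaches every level. *)
  have [b [bm be bs]] := chain_start em; exists b.
  rewrite /L bm be chain_end_id ?Iends // eqxx /=.
  by have [] := b_end _ bs; rewrite permKV => -> _; rewrite /lev; lia.
pose z e j := [arg max_(a > xchoose (Lex e j) | L e j a) x a]%N.
have zP e j : L e j (z e j) /\ forall a, L e j a -> x a <= x (z e j).
  by rewrite /z; case: arg_maxnP => //; apply: xchooseP.
(* Otherwise the next point of the chain, whose [beta] is this [alpha], would reach the level
   further right; at the end of the chain [alpha] is 0. *)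
have zal e j : alpha (z e j) < lev j.
  have [/and3P[zm /eqP ze zb] zmax] := zP e j.
  have [asc|nasc] := boolP (ascent s (z e j)); last first.
    have [|_ ->] := b_end (z e j); rewrite ?inE ?zm //.
  rewrite -b_asc // ltnNge; apply/negP => le.
  have st : step s (z e j) = s (z e j) by rewrite /step asc.
  have := zmax (s (z e j)); rewrite /L -st moved_step chain_end_step zm ze eqxx st le.
  by move=> /(_ isT); move: asc; rewrite /ascent /ne; lia.
apply: (@sort_levels _ _ z cI).
  move=> e j j' jj'.
  have [/and3P[zm /eqP ze zb] zmax] := zP e j.
  have [/and3P[zm' /eqP ze' zb'] zmax'] := zP e j'.
  have jN := ltn_ord j'.
  have levj : lev j = (lev j').+2 by rewrite /lev; lia.
  have xle : x (z e j) <= x (z e j').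
    by apply: zmax'; rewrite /L zm ze eqxx; lia.
  (* Were the two points equal, [beta] would exceed [alpha] there by more than 2. *)
  have := zal e j'; have := b2 (z e j').
  have: chain_end s (z e j) = chain_end s (z e j') by rewrite ze ze'.
  case/chain_comparable => //; last by rewrite /ne; lia.
  by move=> <-; lia.
move=> e e' j ee'.
have [/and3P[zm /eqP ze zb] zmax] := zP e j.
have [/and3P[zm' /eqP ze' zb'] zmax'] := zP e' j.
split; first by apply: contraNneq ee' => zz; apply/eqP/val_inj; rewrite -ze -ze' zz.
by apply/negP => /b_ne; have := zal e j; lia.
Qed.

End PointSets.

(** * Edges of a separated matching as points of the grid *)

Section SeparatedMatching.

Variables (d : Order.disp_t) (V : finOrderType d) (M : ordered_graph V).
Variables (V1 V2 : {set V}).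

Lemma pos_lt (u v : V) : (pos u < pos v) = (u < v)%O.
Proof.
apply/idP/idP => [|uv].
  rewrite [(u < v)%O]ltNge; apply: contraTN => vu; rewrite -leqNgt /pos.
  by apply: subset_leq_card; apply/subsetP => w; rewrite !inE => /lt_le_trans; apply.
rewrite /pos; apply: proper_card; apply/properP; split.
  by apply/subsetP => w; rewrite !inE => /lt_trans; apply.
by exists u; rewrite !inE ?ltxx.
Qed.

Lemma pos_inj : injective (@pos d V).
Proof.
by move=> u v; case: (ltgtP u v) => // uv eq_p; move: uv; rewrite -pos_lt eq_p ltnn.
Qed.

Hypotheses (matchM : is_matching M) (bipM : bipartition M V1 V2).
Hypothesis sepV : separated V1 V2.

Lemma edge_sides e : e \in edges M -> e.1 \in V1 /\ e.2 \in V2.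
Proof.
rewrite inE => /andP[lt_e adj_e]; have [_ _ /(_ _ _ adj_e)] := bipM.
case/orP=> /andP[h1 h2]; first by [].
by have := sepV h2 h1; rewrite ltNge ltW.
Qed.

Lemma gridx_edge e : e \in edges M -> gridx V1 e = pos e.1.
Proof. by case/edge_sides => h _; rewrite /gridx h. Qed.

Lemma gridy_edge e : e \in edges M -> gridy V2 e = pos e.2.
Proof.
case/edge_sides => h1 h2; have [_ dis _] := bipM.
by rewrite /gridy (disjointFr dis h1).
Qed.

Lemma gridx_inj : {in edges M &, injective (gridx V1)}.
Proof.
move=> [u v] [u' v'] eM fM; rewrite !gridx_edge // => /pos_inj /= eq_u.
move: eM fM; rewrite -{}eq_u !inE /= => /andP[_ uv] /andP[_ uv'].
have /card_le1_eqP := matchM u; move/(_ v v').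
by rewrite !inE uv uv' => -> .
Qed.

Lemma gridy_inj : {in edges M &, injective (gridy V2)}.
Proof.
move=> [u v] [u' v'] eM fM; rewrite !gridy_edge // => /pos_inj /= eq_v.
move: eM fM; rewrite -{}eq_v !inE /= => /andP[_ uv] /andP[_ uv'].
have /card_le1_eqP := matchM v; move/(_ u u').
by rewrite !inE adj_sym uv adj_sym uv' => -> .
Qed.

(** Separation makes the middle inequality of an alternation automatic. *)
Lemma cross_edges e f : e \in edges M -> f \in edges M ->
  cross e f = northeast V1 V2 e f || northeast V1 V2 f e.
Proof.
move=> eM fM; rewrite /northeast /cross !gridx_edge ?gridy_edge // !pos_lt.
have [e1 e2] := edge_sides eM; have [f1 f2] := edge_sides fM.
by rewrite (sepV f1 e2) (sepV e1 f2).
Qed.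

Lemma nests_edges e f : e \in edges M -> f \in edges M ->
  nests e f = southeast V1 V2 e f.
Proof.
move=> eM fM; rewrite /southeast /nests !gridx_edge ?gridy_edge // !pos_lt.
by move: fM; rewrite inE => /andP[->].
Qed.

Lemma is_stackP (S : {set V * V}) : S \subset edges M ->
  reflect {in S &, forall e f, ~~ northeast V1 V2 e f} (is_stack S).
Proof.
move/subsetP=> SM; apply: (iffP forall_inP) => [st e f eS fS|st e eS].
  have /forall_inP/(_ f fS) := st e eS.
  by rewrite cross_edges ?SM // negb_or => /andP[].
by apply/forall_inP => f fS; rewrite cross_edges ?SM // negb_or !st.
Qed.

Lemma is_queueP (S : {set V * V}) : S \subset edges M ->
  reflect {in S &, forall e f, ~~ southeast V1 V2 e f} (is_queue S).
Proof.
move/subsetP=> SM; apply: (iffP forall_inP) => [st e f eS fS|st e eS].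
  by have /forall_inP/(_ f fS) := st e eS; rewrite nests_edges ?SM.
by apply/forall_inP => f fS; rewrite nests_edges ?SM // st.
Qed.

Lemma diamond_page_bound n D (S : {set V * V}) : diamond_pattern M V1 V2 n D ->
  S \subset edges M -> is_stack S || is_queue S -> #|D :&: S| <= n.
Proof.
case=> DM _ [E [DE Ene Ese]] SM pageS.
pose S' := [set ij : 'I_n * 'I_n | E ij.1 ij.2 \in S].
have DS : #|D :&: S| <= #|S'|.
  have : D :&: S \subset [set E ij.1 ij.2 | ij in S'].
    apply/subsetP => e; rewrite inE DE => /andP[/imset2P[i j _ _ ->] eS].
    by apply/imsetP; exists (i, j); rewrite ?inE.
  by move/subset_leq_card/leq_trans; apply; apply: leq_imset_card.
apply: leq_trans DS _.
have proj (p : 'I_n * 'I_n -> 'I_n) : {in S' &, injective p} -> #|S'| <= n.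
  by move/card_in_imset <-; apply: leq_trans (max_card _) _; rewrite card_ord.
have diaE : diamond (gridx V1) (gridy V2) E by [].
case/orP: pageS => [/(is_stackP SM) st|/(is_queueP SM) qu].
  apply: (proj fst) => -[i j] [i' j']; rewrite !inE /= => ES ES' ii'; subst i'.
  congr (_, _); apply: val_inj => /=; case: (ltngtP j j') => // jj.
    by case/negP: (st _ _ ES ES'); apply: (diamond_row diaE i jj).
  by case/negP: (st _ _ ES' ES); apply: (diamond_row diaE i jj).
apply: (proj snd) => -[i j] [i' j']; rewrite !inE /= => ES ES' jj'; subst j'.
congr (_, _); apply: val_inj => /=; case: (ltngtP i i') => // ii.
  by case/negP: (qu _ _ ES ES'); apply: (diamond_col diaE j ii).
by case/negP: (qu _ _ ES' ES); apply: (diamond_col diaE j ii).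
Qed.

(** Double counting: the [n ^ 2] edges of [D] are spread over the pages, at most [n] on each. *)
Lemma diamond_le_layout n D P :
  diamond_pattern M V1 V2 n D -> mixed_layout M P -> n <= #|P|.
Proof.
move=> DD /andP[/and3P[/eqP covP triP _] /forall_inP pages].
have [DM cardD _] := DD.
have [->//|n_gt0] := posnP n.
rewrite -(leq_pmul2r n_gt0) mulnn -cardD.
have cardD_le : #|D| <= \sum_(S in P) #|D :&: S|.
  have DE : D = \bigcup_(S in P) (D :&: S).
    by rewrite -big_distrr /= -/(cover P) covP; apply/esym/setIidPl.
  rewrite {1}DE; apply: (big_ind2 (fun (A : {set V * V}) m => #|A| <= m)) => [|A m B p Am Bp|//].
    by rewrite cards0.
  by rewrite (leq_trans (leq_card_setU A B).1) ?leq_add.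
apply: leq_trans cardD_le _; rewrite -sum_nat_const; apply: leq_sum => S PS.
apply: diamond_page_bound DD _ (pages S PS).
by rewrite -covP; apply: bigcup_sup PS.
Qed.

Lemma coloring_layout n (col : {e | e \in edges M} -> 'I_n + 'I_n) :
  (forall e f, col e = col f ->
     if col e is inl _ then ~~ southeast V1 V2 (val e) (val f)
     else ~~ northeast V1 V2 (val e) (val f)) ->
  exists2 P, mixed_layout M P & #|P| <= 2 * n.
Proof.
move=> colP; pose c e := omap col (insub e).
have cE e (eM : e \in edges M) : c e = Some (col (exist _ e eM)).
  by rewrite /c insubT.
exists (preim_partition c (edges M)).
  rewrite /mixed_layout preim_partitionP; apply/forall_inP => S /imsetP[e0 e0M SE].
  have memS e : e \in S -> e \in edges M /\ c e0 = c e.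
    by rewrite SE => /setIdP[eM /eqP].
  have SM : S \subset edges M by apply/subsetP => e /memS[].
  have mono e f : e \in S -> f \in S -> if col (exist _ e0 e0M) is inl _
      then ~~ southeast V1 V2 e f else ~~ northeast V1 V2 e f.
    move=> /memS[eM +] /memS[fM +]; rewrite (cE _ e0M) (cE _ eM) (cE _ fM).
    by move=> [->] [/colP].
  case: (col _) mono => i mono; apply/orP.
    by right; apply/(is_queueP SM) => e f; apply: mono.
  by left; apply/(is_stackP SM) => e f; apply: mono.
(* Every part is the class of a colour that occurs, so the parts are at most as many as the
   colours. *)
have : preim_partition c (edges M) \subset
    [set [set f in edges M | Some s == c f] | s : 'I_n + 'I_n].
  apply/subsetP => S /imsetP[e eM ->]; apply/imsetP.
  have eM1 : e \in edges M := eM.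
  exists (col (exist _ e eM1)); first by [].
  by rewrite -(cE e eM1).
move/subset_leq_card/leq_trans; apply; apply: leq_trans (leq_imset_card _ _) _.
by rewrite card_sum card_ord mul2n addnn.
Qed.

Lemma diamond_or_layout n :
  (exists D, diamond_pattern M V1 V2 n.+1 D) \/
  (exists2 P, mixed_layout M P & #|P| <= 2 * n).
Proof.
(* On the subtype of edges the coordinates are injective, because a matching has at most one edge at
   each vertex. *)
pose x (e : {e | e \in edges M}) := gridx V1 (val e).
pose y (e : {e | e \in edges M}) := gridy V2 (val e).
have x_inj : injective x.
  by move=> e f /gridx_inj ef; apply/val_inj/ef; apply: valP.
have y_inj : injective y.
  by move=> e f /gridy_inj ef; apply/val_inj/ef; apply: valP.
case: (diamond_or_coloring x_inj y_inj n) => [[E [Ene Ese]]|[col colP]]; last first.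
  by right; apply: (coloring_layout colP).
left; exists [set val (E i j) | i : 'I_n.+1, j : 'I_n.+1]; split.
- by apply/subsetP => e /imset2P[i j _ _ ->]; apply: valP.
- exact: (@card_diamond _ (gridx V1) (gridy V2) _ (fun i j => val (E i j))).
by exists (fun i j => val (E i j)).
Qed.

End SeparatedMatching.

Theorem theorem5 (d : Order.disp_t) (V : finOrderType d) (M : ordered_graph V)
    (V1 V2 : {set V}) (k : nat) :
  is_matching M ->
  bipartition M V1 V2 ->
  separated V1 V2 ->
  largest_diamond M V1 V2 k ->
  k <= mixed_page_number M <= 2 * k.
Proof.
move=> matchM bipM sepV [[D DD] maxD].
rewrite /mixed_page_number; case: ex_minnP => n.
case/existsP=> P /andP[layP /eqP <-] min_n; apply/andP; split.
  exact: diamond_le_layout DD layP.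
case: (diamond_or_layout matchM bipM sepV k) => [[D' /maxD]|[Q layQ Qk]].
  by rewrite ltnn.
by apply: leq_trans Qk; apply: min_n; apply/existsP; exists Q; rewrite layQ eqxx.
Qed.
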